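(* Let $K\subseteq\mathbf{R}^n$ be a nonempty unbounded closed set and let $f=(f_1,\dots,f_q):\mathbf{R}^n\to\mathbf{R}^q$ be a vector polynomial with $\deg f_i=d_i\ge1$, $\mathbf d=(d_1,\dots,d_q)$. Let $\bar x\in K$ and let $I\subseteq\{1,\dots,q\}$ be a nonempty index set. Assume that $f$ is $I$-section-bounded from below at $\bar x$. Then the following are equivalent: (i) the restricted mapping $f|_K$ is $I$-proper at the sublevel $f(\bar x)$; (ii) there exist a closed set $S\subseteq\mathbf{R}^n$ with $(K_{\bar x})_\infty\subseteq S_\infty\subseteq K_\infty$ and $\lambda=(\lambda_1,\dots,\lambda_q)\in\mathbf{R}^q_+\setminus\{0\}$ such that $SOL(S_\infty,\{\sum_{i=1}^q\lambda_i f_i\}^\infty_d)=\{0\}$; (iii) there exists a closed set $S\subseteq\mathbf{R}^n$ with $(K_{\bar x})_\infty\subseteq S_\infty\subseteq K_\infty$ such that $SOL^{w}(S_\infty,f^\infty_{\mathbf d})=\{0\}$; (iv) there exists a closed set $S\subseteq\mathbf{R}^n$ with $(K_{\bar x})_\infty\subseteq S_\infty\subseteq K_\infty$ such that $SOL^{s}(S_\infty,f^\infty_{\mathbf d})=\{0\}$.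
   Context: $\mathbf{R}^q_+$ is the nonnegative orthant; $y\le z$ in $\mathbf{R}^q$ means $z-y\in\mathbf{R}^q_+$. $K_{\bar x}=\{x\in K: f(x)\le f(\bar x)\}$. The asymptotic cone of a nonempty set $S$ is $S_\infty=\{v:\exists\, t_k\to+\infty,\ x_k\in S \text{ with } x_k/t_k\to v\}$. For a polynomial $p$ of degree $d$, $p^\infty_d(x)=\lim_{t\to+\infty}p(tx)/t^d$, and $f^\infty_{\mathbf d}=((f_1)^\infty_{d_1},\dots,(f_q)^\infty_{d_q})$; in $\{\sum_i\lambda_i f_i\}^\infty_d$ the index is $d=\deg\sum_i\lambda_i f_i$. $SOL(A,p)$ is the set of global minimizers of the scalar function $p$ over $A$. $SOL^{s}(A,g)=\{x^*\in A: g(x)-g(x^* )\notin-\mathbf{R}^q_+\setminus\{0\}\ \forall x\in A\}$, $SOL^{w}(A,g)=\{x^*\in A: g(x)-g(x^* )\notin-\operatorname{int}\mathbf{R}^q_+\ \forall x\in A\}$. $f$ is $I$-section-bounded from below at $\bar x$ if for every $i\in I$ the function $f_i$ is bounded from below on $K_{\bar x}$. For $I=\{s_1,\dots,s_p\}$, $f_I=(f_{s_1},\dots,f_{s_p})$. $f|_K$ is $I$-proper at the sublevel $\bar y\in\mathbf{R}^q$ if for every sequence $\{x_k\}\subseteq K$ with $\|x_k\|\to+\infty$ and $f(x_k)\le\bar y$ for all $k$, one has $\|f_I(x_k)\|\to+\infty$. *)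

(* Defs.v *)
(* MathComp-Analysis; the polynomials are those of multinomials, whose file
   mpoly is imported (for its canonical instances) without its notations, which
   clash with those of the former: mpoly.mpoly n R is {mpoly R[n]}. *)
From HB Require Import structures.
From mathcomp Require Import all_boot all_order all_algebra.
From mathcomp Require Import all_classical all_reals all_analysis.
From mathcomp Require Import -(notations) mpoly.

Set Implicit Arguments.
Unset Strict Implicit.
Unset Printing Implicit Defensive.

Import Order.TTheory GRing.Theory Num.Theory.
Import numFieldNormedType.Exports.

Local Open Scope classical_set_scope.
Local Open Scope ring_scope.

(* R^n is 'rV[R]_n, with the topology and the (sup) norm of the library; only
   boundedness, closedness and divergence of norms to +oo are used, and these
   do not depend on the choice of a norm on R^n. *)

Definition orthant (R : realType) (q : nat) : set 'rV[R]_q :=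
  [set y | forall i, 0 <= y ord0 i].

Definition cle (R : realType) (q : nat) (y z : 'rV[R]_q) : Prop :=
  orthant (z - y).

Definition peval (R : realType) (n : nat) (p : mpoly.mpoly n R) (x : 'rV[R]_n)
  : R := mpoly.meval (fun i => x ord0 i) p.

(* msize is 1 + degree, and 0 for the zero polynomial, whose degree is
   therefore 0 here (its recession polynomial is 0 for any choice). *)
Definition pdeg (R : realType) (n : nat) (p : mpoly.mpoly n R) : nat :=
  (mpoly.msize p).-1.

Definition recession (R : realType) (n : nat) (d : nat) (p : mpoly.mpoly n R)
    (x : 'rV[R]_n) : R :=
  lim (peval p (t *: x) / t ^+ d @[t --> +oo]).

Definition vpeval (R : realType) (n q : nat) (f : 'I_q -> mpoly.mpoly n R)
    (x : 'rV[R]_n) : 'rV[R]_q :=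
  \row_i peval (f i) x.

Definition vrecession (R : realType) (n q : nat) (d : 'I_q -> nat)
    (f : 'I_q -> mpoly.mpoly n R) (x : 'rV[R]_n) : 'rV[R]_q :=
  \row_i recession (d i) (f i) x.

Definition weighted_sum (R : realType) (n q : nat) (lam : 'rV[R]_q)
    (f : 'I_q -> mpoly.mpoly n R) : mpoly.mpoly n R :=
  \sum_i lam ord0 i *: f i.

Definition sublevel (R : realType) (n q : nat) (K : set 'rV[R]_n)
    (f : 'I_q -> mpoly.mpoly n R) (xbar : 'rV[R]_n) : set 'rV[R]_n :=
  [set x | K x /\ cle (vpeval f x) (vpeval f xbar)].

Definition asymptotic_cone (R : realType) (n : nat) (S : set 'rV[R]_n)
  : set 'rV[R]_n :=
  [set v | exists (t : nat -> R) (x : nat -> 'rV[R]_n),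
     [/\ t k @[k --> \oo] --> +oo,
         forall k, S (x k)
       & (t k)^-1 *: x k @[k --> \oo] --> v]].

Definition scalar_sol (R : realType) (n : nat) (A : set 'rV[R]_n)
    (p : 'rV[R]_n -> R) : set 'rV[R]_n :=
  [set xs | A xs /\ forall x, A x -> p xs <= p x].

Definition pareto_sol (R : realType) (n q : nat) (A : set 'rV[R]_n)
    (g : 'rV[R]_n -> 'rV[R]_q) : set 'rV[R]_n :=
  [set xs | A xs /\ forall x, A x ->
     ~ ([set - y | y in @orthant R q] `\` [set 0]) (g x - g xs)].

Definition weak_pareto_sol (R : realType) (n q : nat) (A : set 'rV[R]_n)
    (g : 'rV[R]_n -> 'rV[R]_q) : set 'rV[R]_n :=
  [set xs | A xs /\ forall x, A x ->
     ~ [set - y | y in (@orthant R q)°] (g x - g xs)].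

Definition section_bounded_below (R : realType) (n q : nat)
    (K : set 'rV[R]_n) (f : 'I_q -> mpoly.mpoly n R) (I : {set 'I_q})
    (xbar : 'rV[R]_n) : Prop :=
  forall i, i \in I -> has_lbound (peval (f i) @` sublevel K f xbar).

(* f_I, with I = {s_1, ..., s_p} enumerated by enum_val. *)
Definition vpeval_sub (R : realType) (n q : nat) (f : 'I_q -> mpoly.mpoly n R)
    (I : {set 'I_q}) (x : 'rV[R]_n) : 'rV[R]_#|I| :=
  \row_(j < #|I|) peval (f (enum_val j)) x.

Definition proper_at_sublevel (R : realType) (n q : nat) (K : set 'rV[R]_n)
    (f : 'I_q -> mpoly.mpoly n R) (I : {set 'I_q}) (ybar : 'rV[R]_q) : Prop :=
  forall x : nat -> 'rV[R]_n,
    (forall k, K (x k)) ->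
    `|x k| @[k --> \oo] --> +oo ->
    (forall k, cle (vpeval f (x k)) ybar) ->
    `|vpeval_sub f I (x k)| @[k --> \oo] --> +oo.

(* S is not required to be nonempty: in the theorem the inclusion
   (K_xbar)_oo `<=` S_oo, whose left-hand side contains 0, forces it. *)
Definition cone_between (R : realType) (n q : nat) (K : set 'rV[R]_n)
    (f : 'I_q -> mpoly.mpoly n R) (xbar : 'rV[R]_n) (S : set 'rV[R]_n)
  : Prop :=
  asymptotic_cone (sublevel K f xbar) `<=` asymptotic_cone S /\
  asymptotic_cone S `<=` asymptotic_cone K.

(* Main.v *)
Require Import Defs.
From HB Require Import structures.
From mathcomp Require Import all_boot all_order all_algebra.
From mathcomp Require Import all_classical all_reals all_analysis.
From mathcomp Require Import -(notations) mpoly.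

Import Order.TTheory GRing.Theory Num.Theory.
Import numFieldNormedType.Exports.

Local Open Scope classical_set_scope.
Local Open Scope ring_scope.

(** Write A for the section K_xbar.  All four conditions are equivalent to the
    boundedness of A.

    On A every f_i is at most f_i(xbar), and f_i is bounded below for i in I, so
    f_I is bounded on A.  Hence f_I can only diverge along every divergent
    sequence of A when A has no divergent sequence
    (proper_at_sublevel_bounded).

    If A is bounded, its asymptotic cone is {0}.  The set S = {xbar} has the same
    asymptotic cone, and over {0} each of the three optimisation problems has
    the single solution 0, whatever the weights; for weak Pareto optimality this
    needs an objective, which I provides.

    Conversely, let S be as in (ii), (iii) or (iv).  Dividing f_i(x_k) <=
    f_i(xbar) by the power d_i of t_k, along a sequence of A defining an
    asymptotic direction v, gives in the limit that the recession polynomials do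
    not increase from 0 to v (recession_le_at0); the same holds for nonnegative
    weighted sums.  In each of the three senses of optimality, a feasible point
    at which the objective does not exceed its value at a solution is itself a
    solution (scalar_sol_le, weak_pareto_sol_le, pareto_sol_le), so v is a
    solution and v = 0.  But an unbounded A has a nonzero asymptotic direction,
    by compactness of the unit sphere (unbounded_asymptotic_cone). *)

(** * Recession polynomials as limits *)

Lemma cvg_expr {R : realType} {T : Type} {F : set_system T} {FF : Filter F}
    (g : T -> R) (a : R) (j : nat) :
  g k @[k --> F] --> a -> g k ^+ j @[k --> F] --> a ^+ j.
Proof.
move=> ga; exact: (cvg_comp _ (fun x => x ^+ j) ga (@exprn_continuous R j a)).
Qed.

Lemma cvg_invX {R : realType} {T : Type} {F : set_system T} {FF : Filter F}
    (t : T -> R) (d : nat) :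
  (0 < d)%N -> t k @[k --> F] --> +oo -> (t k ^+ d)^-1 @[k --> F] --> 0.
Proof.
move=> d0 ty.
have t_gt0 : \forall k \near F, 0 < t k by move/cvgryPgt: (ty); exact.
have tV0 : (t k)^-1 @[k --> F] --> (0 : R) by exact/(gtr0_cvgV0 t_gt0).
under eq_fun do rewrite -exprVn.
have <- : 0 ^+ d = 0 :> R by rewrite expr0n gtn_eqF.
exact: cvg_expr.
Qed.

(** A monomial of degree e contributes t^(e - d) = (1/t)^(d - e) times its value
    at u, so everything is polynomial in 1/t and u.  The limit puts 0 for 1/t;
    as 0 ^+ 0 = 1, exactly the monomials of degree d survive. *)
Lemma cvg_peval_scaled_sum {R : realType} {n : nat} (p : mpoly.mpoly n R)
    (d : nat) {T : Type} {F : set_system T} {FF : Filter F}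
    (t : T -> R) (u : T -> 'rV[R]_n) (v : 'rV[R]_n) :
  (pdeg p <= d)%N -> t k @[k --> F] --> +oo -> u k @[k --> F] --> v ->
  peval p (t k *: u k) / t k ^+ d @[k --> F] -->
  \sum_(m <- mpoly.msupp p)
    mpoly.mcoeff m p *
      (0 ^+ (d - mpoly.mdeg m) * \prod_i v ord0 i ^+ fun_of_multinom m i).
Proof.
move=> pd ty uv.
have t_gt0 : \forall k \near F, 0 < t k by move/cvgryPgt: (ty); exact.
have tV0 : (t k)^-1 @[k --> F] --> (0 : R) by exact/(gtr0_cvgV0 t_gt0).
have cvg_sum : (\sum_(m <- mpoly.msupp p) mpoly.mcoeff m p *
      ((t k)^-1 ^+ (d - mpoly.mdeg m) *
       \prod_i u k ord0 i ^+ fun_of_multinom m i)) @[k --> F] -->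
  \sum_(m <- mpoly.msupp p)
    mpoly.mcoeff m p *
      (0 ^+ (d - mpoly.mdeg m) * \prod_i v ord0 i ^+ fun_of_multinom m i).
  apply: (cvg_big add_continuous) => m _.
  apply: cvgMl_tmp; apply: cvgM; first exact: cvg_expr.
  apply: (cvg_big mul_continuous) => i _; apply: cvg_expr.
  exact: (cvg_comp u (fun M : 'rV[R]_n => M ord0 i) uv
            (@coord_continuous R 1 n ord0 i v)).
apply: cvg_trans cvg_sum; apply: near_eq_cvg.
apply: filterS t_gt0 => k tk0; rewrite /peval mpoly.mevalE mulr_suml.
rewrite big_seq [RHS]big_seq; apply: eq_bigr => m mp.
have md : (mpoly.mdeg m <= d)%N.
  have := mpoly.msize_mdeg_lt mp; move: pd; rewrite /pdeg.
  by case: (mmeasure _ _) => // s sd ms; exact: leq_trans sd.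
under [in RHS]eq_bigr do rewrite mxE exprMn.
rewrite big_split/= prodrXr -mpoly.mdegE -mulrA; congr (_ * _).
rewrite mulrAC; congr (_ * _).
rewrite -{2}(subnK md) exprD invfM mulrCA mulfV ?expf_neq0 ?gt_eqF// mulr1.
by rewrite exprVn.
Qed.

(** The recession polynomial is defined as a limit along the fixed ray through
    v; the limit is the same when the direction only tends to v, which is what
    sequences defining an asymptotic direction require. *)
Lemma cvg_peval_recession {R : realType} {n : nat} (p : mpoly.mpoly n R)
    (d : nat) {T : Type} {F : set_system T} {FF : Filter F}
    (t : T -> R) (u : T -> 'rV[R]_n) (v : 'rV[R]_n) :
  (pdeg p <= d)%N -> t k @[k --> F] --> +oo -> u k @[k --> F] --> v ->
  peval p (t k *: u k) / t k ^+ d @[k --> F] --> recession d p v.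
Proof.
move=> pd ty uv; rewrite /recession.
have ray := cvg_peval_scaled_sum p d id (fun=> v) v pd cvg_id (cvg_cst v).
rewrite (cvg_lim _ (ray _ _))//; exact: cvg_peval_scaled_sum.
Qed.

Lemma recession_at0 {R : realType} {n : nat} (p : mpoly.mpoly n R) (d : nat) :
  (0 < d)%N -> recession d p 0 = 0.
Proof.
move=> d0; apply: cvg_lim => //=.
under eq_fun do rewrite scaler0.
rewrite -(mulr0 (peval p 0)); apply: cvgMl_tmp.
exact: (cvg_invX id d d0 cvg_id).
Qed.

(** A weighted sum of nonconstant polynomials may be constant, by
    cancellation; its recession polynomial is then its constant value, and need
    not vanish at 0. *)
Lemma recession_constant {R : realType} {n : nat} (p : mpoly.mpoly n R)
    (v w : 'rV[R]_n) :
  pdeg p = 0%N -> recession 0 p v = recession 0 p w.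
Proof.
rewrite /pdeg => p0.
have psize : (mpoly.msize p <= 1)%N by case: (mmeasure _ _) p0 => // -[].
rewrite /recession /peval (mpoly.msize1_polyC psize).
apply: (congr1 (fun g : R -> R => lim (g t @[t --> +oo]))).
by apply/funext => t; rewrite !mpoly.mevalC.
Qed.

(** * Asymptotic cones of bounded and unbounded sets *)

Lemma bounded_setE {R : realType} {V : normedModType R} (A : set V) :
  bounded_set A <-> exists M : R, forall x, A x -> `|x| <= M.
Proof.
split=> [bA|[M AM]].
  have [M _ AM] := pinfty_ex_gt0 bA; exists M; exact: AM.
exists M; split; first exact: num_real.
by move=> N MN x /AM /le_trans; apply; exact: ltW.
Qed.

Lemma unbounded_seq {R : realType} {V : normedModType R} (A : set V) :
  ~ bounded_set A ->
  exists x : nat -> V, forall k, A (x k) /\ k%:R < `|x k|.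
Proof.
move=> unbA.
have /choice[x xP] (k : nat) : exists x, A x /\ k%:R < `|x|; last by exists x.
apply: contrapT => nx; apply: unbA.
apply/bounded_setE; exists k%:R => x Ax /=.
by rewrite leNgt; apply/negP => kx; apply: nx; exists x.
Qed.

(** Normalise a divergent sequence of A: the directions lie in the compact unit
    sphere, and any cluster point of them is an asymptotic direction of norm 1. *)
Lemma unbounded_asymptotic_cone {R : realType} {n : nat} (A : set 'rV[R]_n) :
  ~ bounded_set A -> exists2 v, asymptotic_cone A v & v != 0.
Proof.
move=> /unbounded_seq[x xP].
have x_gt0 k : 0 < `|x k| by apply: le_lt_trans (xP k).2.
pose w k := `|x k|^-1 *: x k.
have normw k : `|w k| = 1.
  by rewrite normrZ normfV normr_id mulVf// gt_eqF.
have sphere_compact : compact [set y : 'rV[R]_n | `|y| = 1].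
  apply: bounded_closed_compact.
    by apply/bounded_setE; exists 1 => y /= ->.
  have -> : [set y : 'rV[R]_n | `|y| = 1] = Num.norm @^-1` [set 1] by [].
  apply: preimage_closed; last exact: closed_eq.
  by move=> y _; exact: norm_continuous.
have [|v [v1 clv]] := sphere_compact (w k @[k --> \oo]) _ _.
  by exists 0%N => // k _; exact: normw.
have /choice[j jP] (k : nat) : exists j, (k <= j)%N /\ `|v - w j| < k.+1%:R^-1.
  have Wk : (w @ \oo) [set w j | j in [set j | (k <= j)%N]].
    by exists k => // i ki; exists i.
  have e_gt0 : 0 < k.+1%:R^-1 :> R by rewrite invr_gt0.
  have [_ [[j kj <-] bj]] := clv _ _ Wk (nbhsx_ballx v _ e_gt0).
  by exists j; split => //; move: bj; rewrite -ball_normE.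
exists v; last by rewrite -normr_eq0 v1 oner_eq0.
exists (fun k => `|x (j k)|), (fun k => x (j k)); split.
- apply: ger_cvgy (@cvgr_idn R); apply: nearW => k.
  apply: ltW; apply: le_lt_trans (xP (j k)).2.
  by rewrite ler_nat; exact: (jP k).1.
- by move=> k; exact: (xP _).1.
- apply/cvgrPdist_lt => e e0; near=> k.
  apply: lt_trans (jP k).2 _; near: k.
  exact: (cvgr_lt 0 cvg_harmonic e e0).
Unshelve. all: by end_near. Qed.

Lemma asymptotic_cone0 {R : realType} {n : nat} (A : set 'rV[R]_n) :
  A !=set0 -> asymptotic_cone A 0.
Proof.
move=> [a Aa]; exists (fun k => k.+1%:R), (fun=> a); split => //.
  by apply: ger_cvgy (@cvgr_idn R); apply: nearW => k; rewrite ler_nat.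
rewrite -(scale0r a); apply: cvgZr_tmp; exact: cvg_harmonic.
Qed.

Lemma bounded_asymptotic_cone {R : realType} {n : nat} (A : set 'rV[R]_n) :
  bounded_set A -> asymptotic_cone A `<=` [set 0].
Proof.
move=> /bounded_setE[M AM] v [t [x [ty Ax tx]]].
have t_gt0 : \forall k \near \oo, 0 < t k by move/cvgryPgt: (ty); exact.
have tV0 : (t k)^-1 @[k --> \oo] --> (0 : R) by exact/(gtr0_cvgV0 t_gt0).
apply/eqP; rewrite -normr_le0 -(mul0r M).
apply: ler_cvg_to (cvg_norm tx) (cvgMr_tmp (b := M) tV0) _.
apply: filterS t_gt0 => k tk0.
rewrite normrZ normfV gtr0_norm// ler_pM2l ?invr_gt0//; exact: AM.
Qed.

Lemma bounded_asymptotic_cone_eq0 {R : realType} {n : nat}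
    (A : set 'rV[R]_n) :
  A !=set0 -> bounded_set A -> asymptotic_cone A = [set 0].
Proof.
move=> A0 bA; apply/seteqP; split; first exact: bounded_asymptotic_cone.
by move=> _ ->; exact: asymptotic_cone0.
Qed.

(** * Polynomials bounded above along asymptotic directions *)

(** When the degree is positive, the right-hand side is 0, the limit of c divided
    by a power of t_k. *)
Lemma recession_le_at0 {R : realType} {n : nat} (p : mpoly.mpoly n R)
    (A : set 'rV[R]_n) (c : R) (v : 'rV[R]_n) :
  (forall x, A x -> peval p x <= c) -> asymptotic_cone A v ->
  recession (pdeg p) p v <= recession (pdeg p) p 0.
Proof.
move=> pc [t [x [ty Ax tx]]].
have [p0|p0] := posnP (pdeg p).
  by rewrite p0 (recession_constant _ v 0 p0).
rewrite recession_at0// -(mulr0 c).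
have t_gt0 : \forall k \near \oo, 0 < t k by move/cvgryPgt: (ty); exact.
apply: ler_cvg_to (cvg_peval_recession _ _ _ _ _ (leqnn _) ty tx)
  (cvgMl_tmp (a := c) (cvg_invX _ _ p0 ty)) _.
apply: filterS t_gt0 => k tk0.
rewrite scalerA mulfV ?gt_eqF// scale1r ler_pM2r ?invr_gt0 ?exprn_gt0//.
exact: pc.
Qed.

Lemma sublevel_peval_le {R : realType} {n q : nat} {K : set 'rV[R]_n}
    {f : 'I_q -> mpoly.mpoly n R} {xbar : 'rV[R]_n} (i : 'I_q)
    (x : 'rV[R]_n) :
  sublevel K f xbar x -> peval (f i) x <= peval (f i) xbar.
Proof. by move=> [_ /(_ i)]; rewrite !mxE subr_ge0. Qed.

Lemma peval_weighted_sum {R : realType} {n q : nat} (lam : 'rV[R]_q)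
    (f : 'I_q -> mpoly.mpoly n R) (x : 'rV[R]_n) :
  peval (weighted_sum lam f) x = \sum_i lam ord0 i * peval (f i) x.
Proof.
by rewrite /peval raddf_sum; apply: eq_bigr => i _; rewrite /= mpoly.mevalZ.
Qed.

Lemma vrecession_le_at0 {R : realType} {n q : nat} {K : set 'rV[R]_n}
    {f : 'I_q -> mpoly.mpoly n R} {d : 'I_q -> nat} {xbar v : 'rV[R]_n} :
  (forall i, pdeg (f i) = d i) -> asymptotic_cone (sublevel K f xbar) v ->
  cle (vrecession d f v) (vrecession d f 0).
Proof.
move=> deg_f Kv i; rewrite !mxE subr_ge0 -deg_f.
exact: recession_le_at0 (sublevel_peval_le i) Kv.
Qed.

Lemma weighted_recession_le_at0 {R : realType} {n q : nat} {K : set 'rV[R]_n}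
    {f : 'I_q -> mpoly.mpoly n R} {lam : 'rV[R]_q} {xbar v : 'rV[R]_n} :
  orthant lam -> asymptotic_cone (sublevel K f xbar) v ->
  recession (pdeg (weighted_sum lam f)) (weighted_sum lam f) v <=
  recession (pdeg (weighted_sum lam f)) (weighted_sum lam f) 0.
Proof.
move=> lam0; apply: recession_le_at0 => x Kx.
rewrite !peval_weighted_sum; apply: ler_sum => i _.
by apply: ler_wpM2l; [exact: lam0 | exact: (sublevel_peval_le _ _ Kx)].
Qed.

(** * Stability of solution sets under domination *)

Lemma orthant_interiorD {R : realType} {q : nat} (y z : 'rV[R]_q) :
  (@orthant R q)° y -> orthant z -> (@orthant R q)° (y + z).
Proof.
move=> yint zpos.
have sub_cvg : (a - z) @[a --> y + z] --> y.
  have := cvgB (@cvg_id _ (nbhs (y + z))) (cvg_cst z).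
  by rewrite addrK; apply.
apply: (@filterS _ (nbhs (y + z)) _ _ _ _ (sub_cvg _ yint)) => a az i.
have := addr_ge0 (az i) (zpos i); by rewrite !mxE subrK.
Qed.

(** The index i says that the space is not reduced to 0, in which case 0 would be
    interior. *)
Lemma not_orthant_interior0 {R : realType} {q : nat} (i : 'I_q) :
  ~ (@orthant R q)° 0.
Proof.
move=> int0.
(* 0 is approached from the interior of the negative orthant. *)
have cvg0 : ((- harmonic k) *: const_mx 1 : 'rV[R]_q) @[k --> \oo] -->
    (0 : 'rV[R]_q).
  rewrite -(scale0r (const_mx 1)); apply: cvgZr_tmp.
  by rewrite -oppr0; apply: cvgN; exact: cvg_harmonic.
have [k /(_ i)] := @filter_ex _ \oo _ _ (cvg0 _ int0).
by rewrite !mxE mulr1 oppr_ge0 leNgt invr_gt0 ltr0Sn.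
Qed.

Lemma scalar_sol_le {R : realType} {n : nat} (A : set 'rV[R]_n)
    (p : 'rV[R]_n -> R) (a v : 'rV[R]_n) :
  scalar_sol A p a -> A v -> p v <= p a -> scalar_sol A p v.
Proof. by move=> [_ pmin] Av pva; split => // x /pmin; exact: le_trans. Qed.

(** Strict domination of v at x yields strict domination of a at x, because
    adding an element of the orthant to an interior one stays in the interior. *)
Lemma weak_pareto_sol_le {R : realType} {n q : nat} (A : set 'rV[R]_n)
    (g : 'rV[R]_n -> 'rV[R]_q) (a v : 'rV[R]_n) :
  weak_pareto_sol A g a -> A v -> cle (g v) (g a) -> weak_pareto_sol A g v.
Proof.
move=> [_ amin] Av gva; split => // x Ax [y yint ygx]; apply: (amin x Ax).
exists (y + (g a - g v)); first exact: orthant_interiorD.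
by rewrite opprD ygx opprB addrA subrK.
Qed.

(** Optimality of a leaves no room for a strict improvement at v, so g takes the
    same value at both points. *)
Lemma pareto_sol_le {R : realType} {n q : nat} (A : set 'rV[R]_n)
    (g : 'rV[R]_n -> 'rV[R]_q) (a v : 'rV[R]_n) :
  pareto_sol A g a -> A v -> cle (g v) (g a) -> pareto_sol A g v.
Proof.
move=> [_ amin] Av gva; split => // x Ax; suff -> : g v = g a by exact: amin.
apply/eqP; rewrite -subr_eq0; apply: contrapT => gneq; apply: (amin v Av).
by split; [exists (g a - g v) => //; rewrite opprB | exact/eqP/negP].
Qed.

(** * Boundedness of the section *)

(** On the section the components f_i, i in I, lie between a lower bound and
    f_i(xbar), so properness there can only hold vacuously. *)
Lemma proper_at_sublevel_bounded {R : realType} {n q : nat} {K : set 'rV[R]_n}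
    {f : 'I_q -> mpoly.mpoly n R} {I : {set 'I_q}} {xbar : 'rV[R]_n} :
  section_bounded_below K f I xbar ->
  proper_at_sublevel K f I (vpeval f xbar) <->
  bounded_set (sublevel K f xbar).
Proof.
move=> fb; split => [prop|/bounded_setE[M KM] x Kx + fx].
  apply: contrapT => /unbounded_seq[x xP].
  have /cvgryPgt fIy : `|vpeval_sub f I (x k)| @[k --> \oo] --> +oo.
    apply: prop => [k||k]; [by have [[]] := xP k| |by have [[]] := xP k].
    by apply: ger_cvgy (@cvgr_idn R); apply: nearW => k; apply: ltW (xP k).2.
  have /choice[l lP] (j : 'I_#|I|) : exists l, forall k,
      l <= peval (f (enum_val j)) (x k).
    have [l lP] := fb _ (enum_valP j); exists l => k; apply: lP.
    by exists (x k) => //; exact: (xP k).1.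
  (* The maximum of the summands would do; a sum is easier to bound below. *)
  pose M := \sum_j (`|l j| + `|peval (f (enum_val j)) xbar|).
  have [k /=] := filter_ex (fIy M).
  apply/negP; rewrite -leNgt [leLHS]/Num.norm/= mx_normrE.
  apply: bigmax_le => [|[i j] _ /=].
    by apply: sumr_ge0 => j _; apply: addr_ge0.
  rewrite mxE /M (bigD1 j)//= -[leLHS]addr0.
  apply: lerD; last by apply: sumr_ge0 => ? _; apply: addr_ge0.
  rewrite ler_norml; apply/andP; split.
    apply: le_trans (lP j k); rewrite lerNl (le_trans (ler_norm _))//.
    by rewrite normrN lerDl.
  apply: le_trans (sublevel_peval_le _ _ (xP k).1) _.
  by rewrite (le_trans (ler_norm _))// lerDr.
move=> /cvgryPgt/(_ M)/filter_ex[k]; rewrite ltNge => /negP[].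
by apply: KM; split.
Qed.

(** The common shape of the three converse implications: sol is a solution set
    over the asymptotic cone of S, and the last hypothesis says that asymptotic
    directions of A inherit optimality from 0. *)
Lemma bounded_of_sol_eq0 {R : realType} {n : nat} (A S : set 'rV[R]_n)
    (sol : set 'rV[R]_n) :
  asymptotic_cone A `<=` asymptotic_cone S -> sol = [set 0] ->
  (forall v, sol 0 -> asymptotic_cone S v -> asymptotic_cone A v -> sol v) ->
  bounded_set A.
Proof.
move=> AS sol0 stable; apply: contrapT => /unbounded_asymptotic_cone[v Av].
move/negP; apply; apply/eqP; have := stable v; rewrite sol0; apply => //.
exact: AS.
Qed.

(** * The equivalence *)

Theorem theorem9 (R : realType) (n q : nat) (K : set 'rV[R]_n)
    (f : 'I_q -> mpoly.mpoly n R) (d : 'I_q -> nat)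
    (xbar : 'rV[R]_n) (I : {set 'I_q})
    (K_nonempty : K !=set0)
    (K_unbounded : ~ bounded_set K)
    (K_closed : closed K)
    (deg_f : forall i, pdeg (f i) = d i)
    (d_ge1 : forall i, (1 <= d i)%N)
    (K_xbar : K xbar)
    (I_nonempty : I != finset.set0)
    (f_bounded : section_bounded_below K f I xbar) :
  [<-> proper_at_sublevel K f I (vpeval f xbar);
       exists (S : set 'rV[R]_n) (lam : 'rV[R]_q),
         [/\ closed S,
             cone_between K f xbar S,
             (@orthant R q `\` [set 0]) lam
           & scalar_sol (asymptotic_cone S)
               (recession (pdeg (weighted_sum lam f)) (weighted_sum lam f))
             = [set 0]];
       exists S : set 'rV[R]_n,
         [/\ closed S,
             cone_between K f xbar S
           & weak_pareto_sol (asymptotic_cone S) (vrecession d f) = [set 0]];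
       exists S : set 'rV[R]_n,
         [/\ closed S,
             cone_between K f xbar S
           & pareto_sol (asymptotic_cone S) (vrecession d f) = [set 0]]].
Proof.
have cone_xbar : asymptotic_cone [set xbar] = [set 0].
  apply: bounded_asymptotic_cone_eq0; first by exists xbar.
  by apply/bounded_setE; exists `|xbar| => x ->.
have closed_xbar : closed [set xbar].
  exact: accessible_closed_set1 (hausdorff_accessible (@norm_hausdorff _ _)) _.
have between_xbar : bounded_set (sublevel K f xbar) ->
    cone_between K f xbar [set xbar].
  move=> bA; split; rewrite cone_xbar; first exact: bounded_asymptotic_cone.
  by move=> _ ->; apply: asymptotic_cone0; exists xbar.
have sol_over0 (P : set 'rV[R]_n) :
    P 0 -> [set x | [set 0] x /\ P x] = [set 0].
  by move=> P0; apply: setIidl => _ ->.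
have /set0Pn[i0 _] := I_nonempty.
tfae.
- move=> /(proper_at_sublevel_bounded f_bounded) bA.
  exists [set xbar], (const_mx 1); split => //; first exact: between_xbar.
    split; first by move=> i; rewrite mxE.
    by move=> /rowP/(_ i0)/eqP; rewrite !mxE oner_eq0.
  by rewrite cone_xbar; apply: sol_over0 => _ ->.
- move=> [S [lam [_ [AS _] [lam0 _] sol0]]].
  have bA : bounded_set (sublevel K f xbar).
    apply: bounded_of_sol_eq0 AS sol0 _ => v s0 Sv Av.
    exact: scalar_sol_le s0 Sv (weighted_recession_le_at0 lam0 Av).
  exists [set xbar]; split => //; first exact: between_xbar.
  rewrite cone_xbar; apply: sol_over0 => _ ->; rewrite subrr => -[y yint].
  move=> /eqP; rewrite oppr_eq0 => /eqP y0; move: yint; rewrite y0.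
  exact: (not_orthant_interior0 i0).
- move=> [S [_ [AS _] sol0]].
  have bA : bounded_set (sublevel K f xbar).
    apply: bounded_of_sol_eq0 AS sol0 _ => v s0 Sv Av.
    exact: weak_pareto_sol_le s0 Sv (vrecession_le_at0 deg_f Av).
  exists [set xbar]; split => //; first exact: between_xbar.
  by rewrite cone_xbar; apply: sol_over0 => _ ->; rewrite subrr => -[_]; apply.
- move=> [S [_ [AS _] sol0]].
  apply/(proper_at_sublevel_bounded f_bounded).
  apply: bounded_of_sol_eq0 AS sol0 _ => v s0 Sv Av.
  exact: pareto_sol_le s0 Sv (vrecession_le_at0 deg_f Av).
Qed.
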